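(* Let $\phi \in l_{\infty}$ and $\alpha \in \mathbb{R}$. Then $\phi$ is $C_{\infty}$ summable to $\alpha$ if and only if \[\lim_{\theta \to \infty}\frac{1}{\log\theta}\sum_{i \in [n, \theta n]}\frac{\phi(i)}{i} = \alpha\] uniformly in $n \in \mathbb{N}$.
   Context: $l_{\infty}$ is the space of bounded real-valued functions on $\mathbb{N} = \{1, 2, \ldots\}$. The Cesàro operator is $C : l_{\infty} \to l_{\infty}$, $(C\phi)(n) = \frac{1}{n}\sum_{i=1}^n\phi(i)$. For $k \ge 1$, $\overline{C}_k(\phi) = \limsup_{n \to \infty}(C^k\phi)(n)$ and $\underline{C}_k(\phi) = \liminf_{n \to \infty}(C^k\phi)(n)$; these are respectively non-increasing and non-decreasing in $k$, and $\overline{C}_{\infty}(\phi) = \lim_{k \to \infty}\overline{C}_k(\phi)$, $\underline{C}_{\infty}(\phi) = \lim_{k \to \infty}\underline{C}_k(\phi)$. $\phi$ is $C_{\infty}$ summable to $\alpha$ if $\overline{C}_{\infty}(\phi) = \underline{C}_{\infty}(\phi) = \alpha$. The sum over $i \in [n, \theta n]$ runs over the integers $i$ with $n \le i \le \theta n$, where $\theta$ is a real parameter. *)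

(* Defs.v *)
From mathcomp Require Import all_boot all_order all_algebra.
From mathcomp Require Import all_classical all_reals all_analysis.
Import Order.TTheory GRing.Theory Num.Theory.
Import numFieldNormedType.Exports.

Set Implicit Arguments.
Unset Strict Implicit.
Unset Printing Implicit Defensive.

Local Open Scope classical_set_scope.
Local Open Scope ring_scope.

(* A function phi on {1, 2, ...} is represented by the sequence phi' : R ^nat
   with phi' j = phi (j + 1); the library's [arithmetic_mean], which sends u to
   n |-> n.+1%:R^-1 * (u 0 + ... + u n), is then the Cesaro operator. *)

Definition cesaro_iter (R : realType) (k : nat) (phi : R ^nat) : R ^nat :=
  iter k (@arithmetic_mean R) phi.

Definition Cupper (R : realType) (k : nat) (phi : R ^nat) : R :=
  limn_sup (cesaro_iter k phi).

Definition Clower (R : realType) (k : nat) (phi : R ^nat) : R :=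
  limn_inf (cesaro_iter k phi).

(* For bounded phi, the sequences below are bounded and monotone in k, so these
   limits exist; the extra term k = 0 does not affect them. *)
Definition Cupper_infty (R : realType) (phi : R ^nat) : R :=
  limn (fun k => Cupper k phi).

Definition Clower_infty (R : realType) (phi : R ^nat) : R :=
  limn (fun k => Clower k phi).

Definition Cinfty_summable_to (R : realType) (phi : R ^nat) (alpha : R) : Prop :=
  Cupper_infty phi = alpha /\ Clower_infty phi = alpha.

(* (1 / log theta) * \sum_(i in [n, theta n]) phi(i) / i for n >= 1, where
   phi(i) is stored at index i.-1; [Num.truncn] is the integer part of a
   nonnegative real. *)
Definition log_mean (R : realType) (phi : R ^nat) (theta : R) (n : nat) : R :=
  (ln theta)^-1 *
  \sum_(n <= i < (Num.truncn (theta * n%:R)).+1) phi i.-1 / i%:R.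

(* Main.v *)
Require Import Defs.
From mathcomp Require Import all_boot all_order all_algebra.
From mathcomp Require Import all_classical all_reals all_analysis.
From mathcomp Require Import ring lra zify.
Import Order.TTheory GRing.Theory Num.Theory.
Import numFieldNormedType.Exports.

Set Implicit Arguments.
Unset Strict Implicit.

Local Open Scope classical_set_scope.
Local Open Scope ring_scope.

(** Write C for the Cesàro operator and u = C f. On the logarithmic scale, both C and the sums over
    [n, theta n] with weights 1/i are averages over multiplicative dilates, and the proof compares
    the two.

    From log means to Cesàro means there is a cheap direction and a Tauberian one. The cheap one
    goes from Cesàro means to log means: f(j) - u(j) is j times an increment of u, so replacing f by
    C f changes a logarithmic sum by a telescoping term plus an absolutely convergent series, that
    is, by a constant independent of the window ([log_sum_arithmetic_mean_bound]). If C^k f is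
    eventually small for some k, division by [ln theta] makes the log means of f small uniformly in
    n ([log_sum_le_of_cesaro_iter]).

    The Tauberian one needs two facts. For suitable k the gap C^k f - C^(k+1) f is uniformly small
    ([normr_cesaro_iter_sub_le]), so C^(k+1) f hardly moves on a window [n, qn]. And C commutes with
    the window sums up to a null sequence ([log_sum_commutator_cvg0]), so uniformly small window
    sums of f give eventually small window sums of C^(k+1) f. A sequence that is nearly constant on
    a window and has a small log mean there is itself small ([cesaro_iter_le_of_log_sum]).
    [Cinfty_summable_toP] turns the limits of upper and lower limits into a statement about one
    iterate. *)

(** * Algebra, positivity and contraction of iterated Cesàro means *)

Lemma arithmetic_meanE (R : realType) (f : R ^nat) n :
  arithmetic_mean f n = n.+1%:R^-1 * \sum_(0 <= i < n.+1) f i.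
Proof. by []. Qed.

Lemma sum_arithmetic_mean (R : realType) (f : R ^nat) n :
  \sum_(0 <= i < n.+1) f i = n.+1%:R * arithmetic_mean f n.
Proof. by rewrite arithmetic_meanE mulVKf// pnatr_eq0. Qed.

Lemma arithmetic_mean0 (R : realType) (f : R ^nat) : arithmetic_mean f 0 = f 0.
Proof. by rewrite arithmetic_meanE big_nat1 invr1 mul1r. Qed.

Lemma arithmetic_meanS (R : realType) (f : R ^nat) n :
  n.+2%:R * arithmetic_mean f n.+1 = n.+1%:R * arithmetic_mean f n + f n.+1.
Proof. by rewrite -!sum_arithmetic_mean [LHS]big_nat_recr. Qed.

Lemma sub_arithmetic_mean (R : realType) (f : R ^nat) n :
  f n.+1 - arithmetic_mean f n.+1 =
  n.+1%:R * (arithmetic_mean f n.+1 - arithmetic_mean f n).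
Proof.
have := arithmetic_meanS f n; rewrite -(natr1 n.+1) mulrDl mul1r => e.
by rewrite mulrBr -[LHS]addr0 -(subrr (n.+1%:R * arithmetic_mean f n)); lra.
Qed.

Lemma arithmetic_mean_diff (R : realType) (f : R ^nat) n :
  arithmetic_mean f n.+1 - arithmetic_mean f n =
  (f n.+1 - arithmetic_mean f n) / n.+2%:R.
Proof.
apply: (mulfI (_ : n.+2%:R != 0)); first by rewrite pnatr_eq0.
rewrite mulrCA divff ?pnatr_eq0// mulr1 mulrBr arithmetic_meanS.
by rewrite -(natr1 n.+1); ring.
Qed.

Lemma ler_arithmetic_mean (R : realType) (f g : R ^nat) n :
  (forall i, (i <= n)%N -> f i <= g i) ->
  arithmetic_mean f n <= arithmetic_mean g n.
Proof.
move=> fg; rewrite !arithmetic_meanE ler_wpM2l ?invr_ge0//.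
by apply: ler_sum_nat => i /andP[_]; rewrite ltnS => /fg.
Qed.

Lemma arithmetic_mean_cst (R : realType) (a : R) :
  arithmetic_mean (fun=> a) = (fun=> a).
Proof.
apply/funext => n; rewrite arithmetic_meanE sumr_const_nat subn0.
by rewrite -(mulr_natl a) mulKf// pnatr_eq0.
Qed.

Lemma arithmetic_meanB (R : realType) (f g : R ^nat) :
  arithmetic_mean (f \- g) = arithmetic_mean f \- arithmetic_mean g.
Proof.
by apply/funext => n /=; rewrite !arithmetic_meanE sumrB mulrBr.
Qed.

Lemma cesaro_iterS (R : realType) k (f : R ^nat) :
  cesaro_iter k.+1 f = arithmetic_mean (cesaro_iter k f).
Proof. by []. Qed.

Lemma cesaro_iterD (R : realType) j k (f : R ^nat) :
  cesaro_iter (j + k) f = cesaro_iter j (cesaro_iter k f).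
Proof. exact: iterD. Qed.

Lemma cesaro_iter_cst (R : realType) k (a : R) :
  cesaro_iter k (fun=> a) = (fun=> a).
Proof. by elim: k => // k IH; rewrite cesaro_iterS IH arithmetic_mean_cst. Qed.

Lemma cesaro_iter_cstE (R : realType) k (a : R) n :
  cesaro_iter k (fun=> a) n = a.
Proof. by rewrite cesaro_iter_cst. Qed.

Lemma cesaro_iterB (R : realType) k (f g : R ^nat) :
  cesaro_iter k (f \- g) = cesaro_iter k f \- cesaro_iter k g.
Proof. by elim: k => // k IH; rewrite !cesaro_iterS IH arithmetic_meanB. Qed.

Lemma cesaro_iterBE (R : realType) k (f g : R ^nat) n :
  cesaro_iter k (fun i => f i - g i) n = cesaro_iter k f n - cesaro_iter k g n.
Proof. by have := congr1 (fun h : R ^nat => h n) (cesaro_iterB k f g). Qed.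

Lemma cesaro_iterN (R : realType) k (f : R ^nat) :
  cesaro_iter k (fun n => - f n) = (fun n => - cesaro_iter k f n).
Proof.
have -> : (fun n => - f n) = (fun=> 0) \- f.
  by apply/funext => n /=; rewrite sub0r.
by rewrite cesaro_iterB cesaro_iter_cst; apply/funext => n /=; rewrite sub0r.
Qed.

Lemma ler_cesaro_iter (R : realType) k (f g : R ^nat) :
  (forall n, f n <= g n) -> forall n, cesaro_iter k f n <= cesaro_iter k g n.
Proof.
move=> fg; elim: k => // k IH n; rewrite !cesaro_iterS.
by apply: ler_arithmetic_mean => i _; exact: IH.
Qed.

Lemma normr_cesaro_iter_le (R : realType) k (f : R ^nat) (M : R) :
  (forall n, `|f n| <= M) -> forall n, `|cesaro_iter k f n| <= M.
Proof.
move=> fM n; rewrite ler_norml.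
rewrite -[X in X <= _](cesaro_iter_cstE k (- M) n).
rewrite -[X in _ && (_ <= X)](cesaro_iter_cstE k M n).
apply/andP; split; apply: ler_cesaro_iter => i.
  by have := fM i; rewrite ler_norml => /andP[].
by have := fM i; rewrite ler_norml => /andP[].
Qed.

                                                                                 
                                                                        
(** * Consecutive Cesàro iterates become uniformly close *)

(** A small iterated mean of a nonnegative sequence at one point forces the sequence to be small on
    average over an initial segment. In the induction the outer mean is restricted to the upper half
    n/2 <= l <= n: each such l already sees all indices up to n / 2^(j+1), and these l make up at
    least half of the indices. *)
Lemma sum_le_cesaro_iter (R : realType) j (h : R ^nat) :
  (forall i, 0 <= h i) -> forall n,
  \sum_(0 <= i < (n %/ 2 ^ j).+1) h i <= 2 ^+ j * n.+1%:R * cesaro_iter j.+1 h n.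
Proof.
move=> h0; elim: j => [|j IH] n.
  by rewrite expn0 divn1 expr0 mul1r sum_arithmetic_mean.
set c := \sum_(0 <= i < _) h i.
have c0 : 0 <= c by apply: sumr_ge0.
have hge l : 0 <= cesaro_iter j.+1 h l.
  by rewrite -(cesaro_iter_cstE j.+1 0 l); apply: ler_cesaro_iter.
have cl l : (n %/ 2 <= l < n.+1)%N ->
    c / (2 ^+ j * n.+1%:R) <= cesaro_iter j.+1 h l.
  move=> /andP[nl ln]; rewrite ler_pdivrMr ?mulr_gt0 ?exprn_gt0// mulrC.
  have cc : c <= \sum_(0 <= i < (l %/ 2 ^ j).+1) h i.
    rewrite /c [leRHS](@big_cat_nat _ _ _ (n %/ 2 ^ j.+1).+1)//=; last first.
      by rewrite ltnS expnS divnMA leq_div2r.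
    by rewrite lerDl sumr_ge0.
  apply: (le_trans cc); apply: (le_trans (IH l)).
  by rewrite ler_wpM2r// ler_wpM2l ?exprn_ge0// ler_nat.
rewrite -mulrA cesaro_iterS -sum_arithmetic_mean.
rewrite (@big_cat_nat _ _ _ (n %/ 2))//=; last by rewrite leqW// leq_div.
apply: (@le_trans _ _ (2 ^+ j.+1 *
    \sum_(n %/ 2 <= i < n.+1) c / (2 ^+ j * n.+1%:R))); last first.
  rewrite ler_pM2l ?exprn_gt0// -[leLHS]add0r; apply: lerD.
    by apply: sumr_ge0 => i _; exact: hge.
  exact: ler_sum_nat cl.
rewrite sumr_const_nat -(mulr_natl (c / _)) exprS.
set N := (n.+1 - _)%N.
have -> : 2 * 2 ^+ j * (N%:R * (c / (2 ^+ j * n.+1%:R))) =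
    c * ((2 * N)%:R / n.+1%:R) :> R.
  have : n.+1%:R != 0 :> R by rewrite pnatr_eq0.
  have : 2 ^+ j != 0 :> R by rewrite expf_neq0.
  by rewrite natrM; move=> ? ?; field; apply/andP.
rewrite -[leLHS]mulr1 ler_wpM2l// ler_pdivlMr// mul1r ler_nat /N; lia.
Qed.

Lemma sum_le_cesaro_iter_le (R : realType) j m (h : R ^nat) n : (j < m)%N ->
  (forall i, 0 <= h i) ->
  \sum_(0 <= i < (n %/ 2 ^ m).+1) h i <= 2 ^+ m * n.+1%:R * cesaro_iter j.+1 h n.
Proof.
move=> jm h0; have hge : 0 <= cesaro_iter j.+1 h n.
  by rewrite -(cesaro_iter_cstE j.+1 0 n); apply: ler_cesaro_iter.
apply: (@le_trans _ _ (\sum_(0 <= i < (n %/ 2 ^ j).+1) h i)).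
  rewrite [leRHS](@big_cat_nat _ _ _ (n %/ 2 ^ m).+1)//=.
    by rewrite lerDl sumr_ge0.
  by rewrite ltnS leq_div2l ?expn_gt0// leq_exp2l// ltnW.
apply: (le_trans (sum_le_cesaro_iter j h0 n)).
rewrite ler_wpM2r// ler_wpM2r// ler_weXn2l// ?ler1n// ltnW//.
Qed.

                                                                              
                                                                     
                                                                 
                                                                   
(** If the gaps g k = C^k f - C^(k+1) f kept a supremum of at least D > 0, then at a point where a
    late gap nearly attains D, positivity would make the m preceding gaps nearly D on average over a
    common initial segment. But these m gaps telescope to at most 2M, which is impossible once m D >
    2M. *)
Lemma cesaro_iter_sub_le (R : realType) (f : R ^nat) (M : R) :
  (forall n, `|f n| <= M) -> forall e : R, 0 < e ->
  exists k, forall n, cesaro_iter k f n - cesaro_iter k.+1 f n <= e.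
Proof.
move=> fM e e0; apply: contrapT => nok.
pose g k n := cesaro_iter k f n - cesaro_iter k.+1 f n.
have gE k j n : cesaro_iter j (g k) n = g (j + k)%N n.
  by rewrite /g -addnS !cesaro_iterD -cesaro_iterBE.
have fkM k n : - M <= cesaro_iter k f n <= M.
  by rewrite -ler_norml normr_cesaro_iter_le.
pose B := [set b : R | exists k, forall n, g k n <= b].
have Be b : B b -> e <= b.
  move=> [k kb]; rewrite leNgt; apply/negP => be; apply: nok.
  by exists k => n; apply: (le_trans (kb n)); exact: ltW.
have hB : has_inf B.
  split; last by exists e.
  exists (2 * M), 0 => n; rewrite /g.
  by have := fkM 0 n; have := fkM 1 n; lra.
pose D := inf B.
have De : e <= D by apply: lb_le_inf => //; case: hB.
have [m m_gt0 mD] : exists2 m : nat, (0 < m)%N & 2 * M + 1 <= m%:R * D.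
  exists (Num.truncn ((2 * M + 1) / D)).+1 => //.
  have D0 : 0 < D by exact: lt_le_trans De.
  by rewrite -ler_pdivrMr// ltW// truncnS_gt.
(* The factors of [P] are the number m of gaps, the loss 2^m in the positivity bound, and the ratio
   2^m between n+1 and the length of the segment. The 4 in [eta] absorbs the width 2 [eta] and
   leaves a factor 2 for the contradiction. *)
pose P : R := m%:R * 2 ^+ m * 2 ^+ m.
have P0 : 0 < P by rewrite !mulr_gt0 ?exprn_gt0 ?ltr0n.
pose eta := (4 * P)^-1.
have eta0 : 0 < eta by rewrite invr_gt0 mulr_gt0.
have [b [k0 k0b] bD] := inf_adherent eta0 hB.
have gk0 k n : g (k + k0)%N n <= D + eta.
  rewrite -gE; apply: (@le_trans _ _ (cesaro_iter k (fun=> D + eta) n)).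
    by apply: ler_cesaro_iter => i; apply: (le_trans (k0b i)); exact: ltW.
  by rewrite cesaro_iter_cst.
have [n gn] : exists n, D - eta < g (m + k0)%N n.
  apply: contrapT => non.
  have : B (D - eta).
    exists (m + k0)%N => n; rewrite leNgt; apply/negP => ?.
    by apply: non; exists n.
  by move/(ge_inf (proj2 hB)); rewrite -/D; lra.
pose h j i := D + eta - g (j + k0)%N i.
have h0 j i : 0 <= h j i by rewrite subr_ge0.
(* C^(m-j) carries every defect [h j] to the defect of the last gap, which is below 2 [eta] at the
   chosen n. *)
have hm j : (j < m)%N -> cesaro_iter (m - j) (h j) n < 2 * eta.
  move=> jm.
  rewrite /h (cesaro_iterBE _ (fun=> D + eta)) cesaro_iter_cstE.
  by rewrite gE addnA subnK ?(ltnW jm)//; lra.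
pose N := (n %/ 2 ^ m).+1.
have up : \sum_(0 <= j < m) \sum_(0 <= i < N) h j i
    <= m%:R * (2 ^+ m * n.+1%:R * (2 * eta)).
  set K := 2 ^+ m * _ * _.
  rewrite mulr_natl -[m in leRHS]subn0 -sumr_const_nat.
  apply: ler_sum_nat => j /andP[_ jm].
  have mj : (m - j.+1 < m)%N by rewrite ltn_subrL m_gt0.
  apply: (le_trans (sum_le_cesaro_iter_le n mj (h0 j))).
  rewrite /K ler_wpM2l ?mulr_ge0 ?exprn_ge0//.
  by rewrite subnSK// ltW// hm.
(* For each i the sum over j of [h j i] is at least m D - 2M, hence at least 1 by the choice of
   m. *)
have low : N%:R <= \sum_(0 <= j < m) \sum_(0 <= i < N) h j i.
  rewrite exchange_big_nat/= -[N in leLHS]subn0 -sumr_const_nat.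
  apply: ler_sum_nat => i _.
  rewrite /h sumrB sumr_const_nat subn0 -(mulr_natl (D + eta)) mulrDr.
  have -> : \sum_(0 <= j < m) g (j + k0)%N i =
      cesaro_iter k0 f i - cesaro_iter (m + k0) f i.
    have tel := telescope_sumr (fun j => cesaro_iter (j + k0) f i) (leq0n m).
    rewrite add0n in tel; rewrite -[RHS]opprB -tel -sumrN.
    by apply: eq_bigr => j _; rewrite opprB.
  have me0 : 0 <= m%:R * eta by rewrite mulr_ge0// ltW.
  by have := fkM k0 i; have := fkM (m + k0)%N i; lra.
have NN : n.+1%:R <= 2 ^+ m * N%:R :> R.
  by rewrite -natrX -natrM ler_nat /N mulnC ltn_ceil ?expn_gt0.
have : 2 * n.+1%:R <= n.+1%:R :> R.
  have e2 : 2 * (2 ^+ m * (m%:R * (2 ^+ m * n.+1%:R * (2 * eta)))) = n.+1%:R.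
    transitivity (n.+1%:R * (4 * P * eta)); first by rewrite /P; ring.
    by rewrite /eta divff ?mulr1// gt_eqF// mulr_gt0.
  rewrite -[leRHS]e2 ler_pM2l// (le_trans NN)//.
  by rewrite ler_wpM2l ?exprn_ge0// (le_trans low).
have : 0 < n.+1%:R :> R by [].
by lra.
Qed.

(** A one-sided bound on a gap survives further averaging, so one k serves both f and -f. *)
Lemma normr_cesaro_iter_sub_le (R : realType) (f : R ^nat) (M : R) :
  (forall n, `|f n| <= M) -> forall e : R, 0 < e ->
  exists k, forall n, `|cesaro_iter k f n - cesaro_iter k.+1 f n| <= e.
Proof.
move=> fM e e0.
have mono (g : R ^nat) k j :
    (forall n, cesaro_iter k g n - cesaro_iter k.+1 g n <= e) ->
    forall n, cesaro_iter (j + k) g n - cesaro_iter (j + k).+1 g n <= e.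
  move=> ge n; rewrite -addnS !cesaro_iterD.
  rewrite -cesaro_iterBE -[leRHS](cesaro_iter_cstE j e n).
  exact: ler_cesaro_iter.
have [k1 /mono k1e] := cesaro_iter_sub_le fM e0.
have fNM n : `|- f n| <= M by rewrite normrN.
have [k2 /mono k2e] := cesaro_iter_sub_le fNM e0.
exists (k1 + k2)%N => n; rewrite ler_norml; apply/andP; split.
  by have := k2e k1 n; rewrite !cesaro_iterN; lra.
by rewrite addnC.
Qed.

(** * Logarithmic sums and the effect of replacing a sequence by its Cesàro mean *)

Definition log_sum (R : realType) (f : R ^nat) (m n : nat) : R :=
  \sum_(m <= j < n) f j / j.+1%:R.

Lemma log_sumB (R : realType) (f g : R ^nat) m n :
  log_sum (fun j => f j - g j) m n = log_sum f m n - log_sum g m n.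
Proof. by rewrite /log_sum -sumrB; apply: eq_bigr => j _; rewrite mulrBl. Qed.

Lemma log_sum_cst (R : realType) (a : R) m n :
  log_sum (fun=> a) m n = a * log_sum (fun=> 1) m n.
Proof.
by rewrite /log_sum mulr_sumr; apply: eq_bigr => j _; rewrite mul1r.
Qed.

Lemma log_sumS (R : realType) (f : R ^nat) m n : (m <= n)%N ->
  log_sum f m n.+1 = log_sum f m n + f n / n.+1%:R.
Proof. by move=> mn; rewrite /log_sum big_nat_recr. Qed.

Lemma normr_log_sum_le (R : realType) (f : R ^nat) (c : R) m n :
  (forall j, (m <= j < n)%N -> `|f j| <= c) ->
  `|log_sum f m n| <= c * log_sum (fun=> 1) m n.
Proof.
move=> fc; rewrite -log_sum_cst; apply: (le_trans (ler_norm_sum _ _ _)).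
apply: ler_sum_nat => j /fc fj.
by rewrite normrM normfV normr_nat ler_wpM2r// invr_ge0.
Qed.

Lemma ln_nat_diff (R : realType) j :
  j.+2%:R^-1 <= ln (j.+2%:R : R) - ln (j.+1%:R : R) <= j.+1%:R^-1.
Proof.
have p1 : 0 < j.+1%:R :> R by [].
have p2 : 0 < j.+2%:R :> R by [].
have e : j.+2%:R = j.+1%:R + 1 :> R by rewrite natr1.
have sub1 x : 0 < x -> ln x <= x - 1 :> R.
  by move=> x0; rewrite -[in ln _](subrK 1 x) addrC le_ln1Dx//; lra.
rewrite -ln_div ?posrE//; apply/andP; split.
  have := sub1 (j.+1%:R / j.+2%:R) (divr_gt0 p1 p2).
  rewrite !ln_div ?posrE//.
  suff : j.+2%:R^-1 = - (j.+1%:R / j.+2%:R - 1) :> R.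
    by move=> h ?; rewrite [leLHS]h -[leRHS]opprB lerN2.
  have ba : j.+2%:R - j.+1%:R = 1 :> R by rewrite e addrC addKr.
  rewrite opprB -[X in X - _](@divff _ (j.+2%:R : R)) ?gt_eqF//.
  by rewrite -mulrBl ba mul1r.
apply: (le_trans (sub1 _ (divr_gt0 p2 p1))).
by rewrite e mulrDl divff ?gt_eqF// mul1r addrC addKr.
Qed.

Lemma log_sum_cst_ge (R : realType) m n : (m <= n)%N ->
  ln n.+1%:R - ln m.+1%:R <= log_sum (fun=> 1 : R) m n.
Proof.
move=> mn; rewrite -(telescope_sumr (fun j => ln (j.+1%:R : R)) mn).
by apply: ler_sum_nat => j _; rewrite mul1r; case/andP: (ln_nat_diff R j).
Qed.

Lemma log_sum_cst_le (R : realType) m n : (m < n)%N ->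
  log_sum (fun=> 1 : R) m n <= 1 + (ln n%:R - ln m.+1%:R).
Proof.
case: n => // n; rewrite ltnS => mn; rewrite /log_sum big_nat_recl//= mul1r.
rewrite lerD ?invf_le1 ?ler1n//.
rewrite -(telescope_sumr (fun j => ln (j.+1%:R : R)) mn).
by apply: ler_sum_nat => j _; rewrite mul1r; case/andP: (ln_nat_diff R j).
Qed.

Lemma sum_inv_sqr_le (R : realType) m n :
  \sum_(m <= j < n) (j.+1%:R ^+ 2)^-1 <= 2 :> R.
Proof.
apply: (@le_trans _ _ (\sum_(0 <= j < n) (j.+1%:R ^+ 2)^-1)).
  have [mn|nm] := leqP m n; last by rewrite big_geq ?sumr_ge0// 1?ltnW.
  by rewrite [leRHS](@big_cat_nat _ _ _ m)//= lerDr sumr_ge0.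
(* The sharper bound is what induction can carry; it also covers n = 0, where the inverse of 0 is
   0. *)
suff : \sum_(0 <= j < n) (j.+1%:R ^+ 2)^-1 <= 2 - n%:R^-1 :> R.
  by move=> /le_trans; apply; rewrite gerBl invr_ge0.
elim: n => [|[|n] IH].
- by rewrite big_nil invr0 subr0.
- by rewrite big_nat1 expr1n invr1; lra.
- rewrite big_nat_recr//=.
  have p1 : 0 < n.+1%:R :> R by [].
  suff : (n.+2%:R ^+ 2)^-1 <= n.+1%:R^-1 - n.+2%:R^-1 :> R.
    by move=> /(lerD IH) /le_trans; apply; rewrite addrA subrK.
  have -> : n.+1%:R^-1 - n.+2%:R^-1 = (n.+1%:R * n.+2%:R)^-1 :> R.
    rewrite -(natr1 n.+1); field.
    by rewrite nat1r natr1 !pnatr_eq0.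
  by rewrite lef_pV2 ?posrE ?mulr_gt0// ?exprn_gt0// expr2 ler_wpM2r// ler_nat.
Qed.

Lemma slow_variation (R : realType) (u : R ^nat) (c : R) a b :
  (forall j, `|u j.+1 - u j| <= c / j.+1%:R) -> (a <= b)%N ->
  `|u b - u a| <= c * (b - a)%:R / a.+1%:R.
Proof.
move=> uc ab; have c0 : 0 <= c by have := uc 0; rewrite divr1; exact: le_trans.
rewrite -(telescope_sumr u ab); apply: (le_trans (ler_norm_sum _ _ _)).
rewrite mulrAC mulr_natr -sumr_const_nat; apply: ler_sum_nat => j /andP[aj _].
by apply: (le_trans (uc j)); rewrite ler_wpM2l// lef_pV2 ?posrE// ler_nat.
Qed.

Lemma arithmetic_mean_diff_le (R : realType) (f : R ^nat) (M : R) j :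
  (forall n, `|f n| <= M) ->
  `|arithmetic_mean f j - arithmetic_mean f j.-1| <= 2 * M / j.+1%:R.
Proof.
move=> fM; have M0 : 0 <= M by exact: le_trans (fM 0).
case: j => [|j] /=; first by rewrite subrr normr0 divr1 mulr_ge0.
rewrite arithmetic_mean_diff normrM normfV normr_nat ler_wpM2r ?invr_ge0//.
apply: (le_trans (ler_normB _ _)); have := fM j.+1.
by have := normr_cesaro_iter_le 1 fM j; rewrite /cesaro_iter/=; lra.
Qed.

(** Termwise this is f(j) - u(j) = j (u(j) - u(j-1)) with j written as (j+1) - 1: after division by
    j+1 the first part telescopes and the second is the correction. At j = 0 the predecessor is 0
    and f(0) = u(0), so both sides vanish. *)
Lemma log_sum_sub_arithmetic_mean (R : realType) (f : R ^nat) m n :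
  let u := arithmetic_mean f in (m <= n)%N ->
  log_sum f m n - log_sum u m n =
  u n.-1 - u m.-1 - log_sum (fun j => u j - u j.-1) m n.
Proof.
move=> u mn; rewrite -log_sumB -(telescope_sumr (fun j => u j.-1) mn) -sumrB.
apply: eq_bigr => -[|j] _ /=; first by
  rewrite /u arithmetic_mean0 !subrr mul0r subrr.
rewrite /u sub_arithmetic_mean -(natr1 j.+1).
by field; rewrite nat1r natr1 pnatr_eq0.
Qed.

Lemma normr_log_sum_diff_le (R : realType) (f : R ^nat) (M : R) m n :
  let u := arithmetic_mean f in (forall i, `|f i| <= M) ->
  `|log_sum (fun j => u j - u j.-1) m n| <=
  2 * M * \sum_(m <= j < n) (j.+1%:R ^+ 2)^-1.
Proof.
move=> u fM; rewrite mulr_sumr; apply: (le_trans (ler_norm_sum _ _ _)).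
apply: ler_sum_nat => j _.
rewrite normrM normfV normr_nat expr2 invfM mulrA ler_wpM2r ?invr_ge0//.
exact: arithmetic_mean_diff_le.
Qed.

(** The two endpoint values cost 2M and the correction, a sum of terms at most 2M / (j+1)^2, costs
    4M. *)
Lemma log_sum_arithmetic_mean_bound (R : realType) (f : R ^nat) (M : R) m n :
  (forall i, `|f i| <= M) ->
  `|log_sum f m n - log_sum (arithmetic_mean f) m n| <= 6 * M.
Proof.
move=> fM; have M0 : 0 <= M by exact: le_trans (fM 0).
have [mn|nm] := leqP m n; last first.
  by rewrite /log_sum !(big_geq (ltnW nm)) subrr normr0 mulr_ge0.
rewrite log_sum_sub_arithmetic_mean//; apply: (le_trans (ler_normB _ _)).
have := normr_log_sum_diff_le m n fM; set E := `|log_sum _ _ _| => EM.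
have : E <= 2 * M * 2.
  by apply: (le_trans EM); rewrite ler_wpM2l ?mulr_ge0 ?sum_inv_sqr_le.
have := normr_cesaro_iter_le 1 fM; rewrite /cesaro_iter/= => uM.
have := ler_normB (arithmetic_mean f n.-1) (arithmetic_mean f m.-1).
by have := uM n.-1; have := uM m.-1; lra.
Qed.

Lemma log_sum_cesaro_iter_bound (R : realType) k (f : R ^nat) (M : R) m n :
  (forall i, `|f i| <= M) ->
  `|log_sum f m n - log_sum (cesaro_iter k f) m n| <= k%:R * (6 * M).
Proof.
move=> fM; elim: k => [|k IH]; first by rewrite subrr normr0 mul0r.
have := log_sum_arithmetic_mean_bound m n (normr_cesaro_iter_le k fM).
rewrite cesaro_iterS -(natr1 k) (mulrDl k%:R) mul1r => /(lerD IH) h.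
apply: (le_trans _ h).
by rewrite -[X in `|X|](subrKA (log_sum (cesaro_iter k f) m n)) ler_normD.
Qed.

Lemma log_sum_le_of_cesaro_iter (R : realType) (f : R ^nat) (M e : R) k N :
  (forall i, `|f i| <= M) -> 0 <= e ->
  (forall n, (N <= n)%N -> `|cesaro_iter k f n| <= e) ->
  exists K : R, forall m n, `|log_sum f m n| <= K + e * log_sum (fun=> 1) m n.
Proof.
move=> fM e0 fe; have M0 : 0 <= M by exact: le_trans (fM 0).
exists (k%:R * (6 * M) + M * N%:R) => m n.
set g := cesaro_iter k f.
(* Each index below [N] contributes at most M, each later one at most e / (j+1). *)
suff : `|log_sum g m n| <= M * (minn n N)%:R + e * log_sum (fun=> 1) m n.
  have MN : M * (minn n N)%:R <= M * N%:R by
    rewrite ler_wpM2l// ler_nat geq_minr.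
  have := log_sum_cesaro_iter_bound k m n fM.
  by have := ler_normD (log_sum f m n - log_sum g m n) (log_sum g m n);
    rewrite subrK -/g; lra.
elim: n => [|n IH].
  by rewrite /log_sum big_geq// normr0 addr_ge0 ?mulr_ge0 ?sumr_ge0.
have [mn|nm] := leqP m n; last first.
  by rewrite /log_sum !(big_geq nm) normr0 addr_ge0// mulr_ge0.
rewrite !log_sumS//; apply: (le_trans (ler_normD _ _)).
rewrite mulrDr addrA mul1r normrM normfV normr_nat.
have [nN|Nn] := ltnP n N.
  have n1 : n.+1%:R^-1 <= 1 :> R by rewrite invf_le1 ?ler1n.
  have : `|g n| / n.+1%:R <= M * 1.
    by apply: ler_pM => //; exact: normr_cesaro_iter_le.
  rewrite (minn_idPl nN) -(natr1 n) mulrDr.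
  move: IH; rewrite (minn_idPl (ltnW nN)).
  have : 0 <= e / (n%:R + 1) by apply: divr_ge0.
  lra.
have h : `|g n| / n.+1%:R <= e / n.+1%:R by rewrite ler_wpM2r ?fe.
by move: IH; rewrite (minn_idPr Nn) (minn_idPr (leqW Nn)) => /lerD; apply.
Qed.

(** * Cesàro means nearly commute with logarithmic window sums *)

Lemma cvg0_of_harmonic_bound (R : realType) (x : R ^nat) (K : R) :
  (forall n, `|x n.+1| <= K / n.+1%:R) -> x n @[n --> \oo] --> (0 : R).
Proof.
move=> xK; rewrite -cvg_shiftS; apply/norm_cvg0P.
apply: (@squeeze_cvgr _ _ _ _ (fun=> 0) (fun n => K * harmonic n)).
- by near=> n; rewrite /= normr_ge0 xK.
- exact: cvg_cst.
- by rewrite -[X in _ --> X](mulr0 K); apply: cvgMr; exact: cvg_harmonic.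
Unshelve. all: by end_near. Qed.

(** An explicit preimage of any sequence under the Cesàro operator; the factor 0 kills the
    predecessor term at n = 0. *)
Lemma arithmetic_mean_inv (R : realType) (y : R ^nat) :
  arithmetic_mean (fun n => n.+1%:R * y n - n%:R * y n.-1) = y.
Proof.
apply/funext => n; rewrite arithmetic_meanE.
by rewrite (telescope_sumr (fun i => i%:R * y i.-1))//= mul0r subr0 mulKf.
Qed.

                                                                          
                                                                          
                                                                          
                       
(** The continuous analogues, the mean over [0, x] and the integral of dt/t over [x, qx], commute
    exactly. In the discrete case the commutator is written as C applied to z - S f, and z - S f is
    shown to be O(1/n); its Cesàro means then tend to 0. *)
Lemma log_sum_commutator_cvg0 (R : realType) (f : R ^nat) (M : R) q :
  (0 < q)%N -> (forall n, `|f n| <= M) ->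
  let S := fun (g : R ^nat) n => log_sum g n (q * n.+1) in
  S (arithmetic_mean f) n - arithmetic_mean (S f) n @[n --> \oo] --> (0 : R).
Proof.
move=> q0 fM S; set u := arithmetic_mean f.
have M0 : 0 <= M by exact: le_trans (fM 0).
have uM : forall i, `|u i| <= M := normr_cesaro_iter_le 1 fM.
pose z n := n.+1%:R * S u n - n%:R * S u n.-1.
have -> : (fun n => S u n - arithmetic_mean (S f) n) =
    arithmetic_mean (fun n => z n - S f n).
  by rewrite (arithmetic_meanB z (S f)) /z arithmetic_mean_inv.
apply: cesaro; apply: (@cvg0_of_harmonic_bound _ _ (5 * M * q%:R)) => p.
rewrite /z /=; set a := (q * p.+1)%N; set b := (q * p.+2)%N.
have ba : b = (a + q)%N by rewrite /a /b mulnS addnC.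
have baq : (b - a)%N = q by rewrite ba addKn.
have pa : (p < a)%N by rewrite /a leq_pmull.
have ab : (a <= b)%N by rewrite ba leq_addr.
have b1 : (p < b)%N by rewrite (leq_trans pa).
(* Moving the window from p to p+1 adds this block of q terms and removes the single term u(p) /
   (p+1). *)
pose T := log_sum u a b.
have Sp : S u p.+1 = S u p + T - u p / p.+1%:R.
  have : log_sum u p b = S u p + T.
    by rewrite /S /T /log_sum -big_cat_nat//= ltnW.
  by rewrite {1}/log_sum big_ltn// => <-; rewrite addrC addKr.
have Sf : S f p.+1 = S u p.+1 +
    (u b.-1 - u p - log_sum (fun j => u j - u j.-1) p.+1 b).
  have := log_sum_sub_arithmetic_mean f b1; rewrite -/u /= => <-.
  by rewrite addrC subrK.
set Err := log_sum (fun j => u j - u j.-1) p.+1 b in Sf.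
have ErrM : `|Err| <= 2 * M * q%:R / p.+1%:R.
  apply: (le_trans (normr_log_sum_diff_le _ _ fM)).
  rewrite -[leRHS]mulrA ler_wpM2l ?mulr_ge0//.
  apply: (@le_trans _ _ (\sum_(p.+1 <= j < b) (p.+2%:R ^+ 2)^-1)).
    apply: ler_sum_nat => j /andP[pj _].
    by rewrite lef_pV2 ?posrE ?exprn_gt0// lerXn2r ?nnegrE// ler_nat.
  rewrite sumr_const_nat -(mulr_natl (_ ^-1)) expr2 invfM mulrA.
  apply: ler_pM => //.
    rewrite ler_pdivrMr// -natrM ler_nat; lia.
  by rewrite lef_pV2 ?posrE// ler_nat.
(* On the block each weight (p+1)/(j+1) is within 1/(p+1) of 1/q, and u varies slowly, so (p+1) [T]
   is nearly the plain mean of q values close to u(b-1). Per term, the weight error costs M / (p+1)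
   and the variation of u costs 2M / (p+1). *)
have TM : `|p.+1%:R * T - u b.-1| <= 3 * M * q%:R / p.+1%:R.
  have qn0 : q%:R != 0 :> R by rewrite pnatr_eq0 -lt0n.
  have -> : p.+1%:R * T - u b.-1 =
      \sum_(a <= j < b) (p.+1%:R * (u j / j.+1%:R) - u b.-1 / q%:R).
    rewrite sumrB -mulr_sumr sumr_const_nat baq.
    by rewrite -(mulr_natl (_ / _)) mulrCA divff// mulr1.
  have -> : 3 * M * q%:R / p.+1%:R = \sum_(a <= j < b) (3 * M / p.+1%:R).
    by rewrite sumr_const_nat baq -(mulr_natl (_ / _)); ring.
  apply: (le_trans (ler_norm_sum _ _ _)).
  apply: ler_sum_nat => j /andP[aj jb].
  have -> : p.+1%:R * (u j / j.+1%:R) - u b.-1 / q%:R =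
      (p.+1%:R / j.+1%:R - q%:R^-1) * u j + (u j - u b.-1) / q%:R.
    by ring.
  apply: (le_trans (ler_normD _ _)).
  have h1 : `|p.+1%:R / j.+1%:R - q%:R^-1 : R| <= p.+1%:R^-1.
    rewrite distrC ger0_norm; last first.
      rewrite subr_ge0 ler_pdivrMr// mulrC ler_pdivlMr ?ltr0n//.
      by rewrite -natrM ler_nat mulnC (leq_trans aj).
    rewrite lerBlDr.
    have hq : (0 : R) < q%:R by rewrite ltr0n.
    apply: (@le_trans _ _ ((p.+2%:R) / (q%:R * p.+2%:R))).
      by rewrite invfM mulrCA divff ?mulr1// pnatr_eq0.
    apply: (@le_trans _ _ (p.+2%:R / j.+1%:R)).
      rewrite ler_wpM2l// lef_pV2 ?posrE// ?mulr_gt0// -natrM ler_nat.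
      exact: jb.
    rewrite -(natr1 p.+1) mulrDl addrC mul1r lerD2r lef_pV2 ?posrE// ler_nat.
    exact: leq_trans (ltnW pa) (leq_trans aj _).
  have h2 : `|u j - u b.-1| <= 2 * M * q%:R / p.+1%:R.
    rewrite distrC; apply: (le_trans (slow_variation (c := 2 * M) _ _)).
    - move=> i; have := arithmetic_mean_diff_le i.+1 fM => /le_trans; apply.
      by rewrite ler_wpM2l ?mulr_ge0// lef_pV2 ?posrE// ler_nat.
    - by rewrite -ltnS prednK// (leq_trans _ jb).
    - apply: ler_pM; rewrite ?invr_ge0 ?mulr_ge0//.
        by rewrite ler_wpM2l ?mulr_ge0// ler_nat; lia.
      by rewrite lef_pV2 ?posrE// ler_nat ltnS (leq_trans _ aj)// ltnW.
  have h3 : `|(p.+1%:R / j.+1%:R - q%:R^-1) * u j| <= p.+1%:R^-1 * M.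
    by rewrite normrM ler_pM.
  have h4 : `|(u j - u b.-1) / q%:R| <= 2 * M / p.+1%:R.
    rewrite normrM normfV normr_nat ler_pdivrMr ?ltr0n//.
    by apply: (le_trans h2); rewrite mulrAC.
  apply: (le_trans (lerD h3 h4)); rewrite [p.+1%:R^-1 * M]mulrC -mulrDl.
  by rewrite ler_wpM2r ?invr_ge0//; lra.
have -> : p.+2%:R * S u p.+1 - p.+1%:R * S u p - S f p.+1 =
    (p.+1%:R * T - u b.-1) + Err.
  rewrite Sf -(natr1 p.+1) Sp; field.
  by rewrite nat1r pnatr_eq0.
apply: (le_trans (ler_normD _ _)); apply: (le_trans (lerD TM ErrM)).
by rewrite -!mulrDl ler_wpM2r ?invr_ge0// ler_wpM2r//; lra.
Qed.

Lemma log_sum_cesaro_iter_commutator_cvg0 (R : realType) (f : R ^nat) (M : R)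
    q k :
  (0 < q)%N -> (forall n, `|f n| <= M) ->
  let S := fun (g : R ^nat) n => log_sum g n (q * n.+1) in
  S (cesaro_iter k f) n - cesaro_iter k (S f) n @[n --> \oo] --> (0 : R).
Proof.
move=> q0 fM S; elim: k => [|k IH].
  by rewrite /cesaro_iter/=; under eq_fun do rewrite subrr; exact: cvg_cst.
have := log_sum_commutator_cvg0 q0 (normr_cesaro_iter_le k fM).
rewrite -/S => /cvgD /(_ (cesaro IH)); rewrite addr0.
rewrite (arithmetic_meanB (S (cesaro_iter k f)) (cesaro_iter k (S f))).
apply: cvg_trans; apply: near_eq_cvg; near=> n.
by rewrite fctE/= addrA subrK.
Unshelve. all: by end_near. Qed.

(** This is the Tauberian step. The hypothesis must hold for all n with one q, because C^(k+1) is
    applied to the whole sequence of window sums and only its contraction for the supremum norm is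
    available. *)
Lemma cesaro_iter_le_of_log_sum (R : realType) (f : R ^nat) (M : R) :
  (forall n, `|f n| <= M) ->
  (forall e : R, 0 < e -> exists2 q, (1 < q)%N &
    forall n, `|log_sum f n (q * n.+1)| <= e * ln q%:R) ->
  forall e : R, 0 < e ->
  exists k, \forall n \near \oo, `|cesaro_iter k f n| <= e.
Proof.
move=> fM fL e e0; have e4 : 0 < e / 4 by rewrite divr_gt0.
have [q q1 fq] := fL _ e4; have q0 : (0 < q)%N by exact: ltnW.
have qR : 0 < q%:R :> R by rewrite ltr0n.
have lnq : 0 < ln q%:R :> R by rewrite ln_gt0// ltr1n.
(* The gap bound is divided by q because the total variation of C^(k+1) f over [n, q(n+1)) is at
   most about q times the gap. *)
have dl0 : 0 < e / 4 / q%:R by rewrite divr_gt0.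
have [k ke] := normr_cesaro_iter_sub_le fM dl0.
exists k.+1.
have elq : 0 < e / 4 * ln q%:R by rewrite mulr_gt0.
have /cvgr0Pnorm_le /(_ _ elq) :=
  log_sum_cesaro_iter_commutator_cvg0 k.+1 q0 fM.
move=> com; near=> n.
set w := cesaro_iter k.+1 f.
set L := log_sum (fun=> 1 : R) n (q * n.+1).
have Lq : ln q%:R <= L.
  apply: (le_trans _ (@log_sum_cst_ge R n (q * n.+1) _)); last first.
    by rewrite (leq_trans (leqnSn n))// leq_pmull.
  rewrite -ln_div ?posrE// ler_ln ?posrE// ?divr_gt0// ler_pdivlMr//.
  by rewrite -natrM ler_nat.
(* One quarter of e comes from the commutator and one from the contracted window sums of f. *)
have Sw : `|log_sum w n (q * n.+1)| <= e / 2 * L.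
  have h1 : `|log_sum w n (q * n.+1) -
      cesaro_iter k.+1 (fun n => log_sum f n (q * n.+1)) n| <= e / 4 * ln q%:R.
    by near: n.
  have h2 : `|cesaro_iter k.+1 (fun n => log_sum f n (q * n.+1)) n| <=
    e / 4 * ln q%:R by exact: normr_cesaro_iter_le.
  have := ler_normD (log_sum w n (q * n.+1) -
      cesaro_iter k.+1 (fun n => log_sum f n (q * n.+1)) n)
    (cesaro_iter k.+1 (fun n => log_sum f n (q * n.+1)) n).
  rewrite subrK => h3.
  have : e / 2 * ln q%:R <= e / 2 * L by rewrite ler_pM2l// divr_gt0.
  by lra.
(* The increment w(i+1) - w(i), multiplied by i+1, is a value of the gap C^k f - C^(k+1) f. *)
have wslow : `|log_sum (fun j => w j - w n) n (q * n.+1)| <= e / 4 * L.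
  apply: normr_log_sum_le => j /andP[nj jq].
  apply: (le_trans (slow_variation (c := e / 4 / q%:R) _ nj)).
    move=> i; rewrite ler_pdivlMr// mulrC -[i.+1%:R]normr_nat -normrM.
    by rewrite /w !cesaro_iterS -sub_arithmetic_mean -cesaro_iterS; exact: ke.
  rewrite ler_pdivrMr// -[leLHS]mulrA ler_pM2l// ler_pdivrMl// -natrM ler_nat.
  lia.
have : `|w n| * L <= e * L.
  have L0 : 0 < L by exact: lt_le_trans Lq.
  rewrite -[in leLHS](gtr0_norm L0) -normrM -/L.
  have -> : w n * L = log_sum w n (q * n.+1)
      - log_sum (fun j => w j - w n) n (q * n.+1).
    by rewrite (log_sumB w) (log_sum_cst (w n)) subKr.
  apply: (le_trans (ler_normB _ _)).
  have : 0 < e * L by rewrite mulr_gt0.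
  by lra.
by rewrite ler_pM2r// (lt_le_trans lnq).
Unshelve. all: by end_near. Qed.

(** * From upper and lower limits to estimates on a single iterate *)

Lemma bounded_fun_of_le (R : realType) (g : R ^nat) (M : R) :
  (forall n, `|g n| <= M) -> bounded_fun g.
Proof.
move=> gM; exists M; split; first exact: num_real.
by move=> b Mb n _; exact: le_trans (gM n) (ltW Mb).
Qed.

Lemma limn_sup_leP (R : realType) (g : R ^nat) (M a : R) :
  (forall n, `|g n| <= M) ->
  limn_sup g <= a <-> forall e, 0 < e -> \forall n \near \oo, g n <= a + e.
Proof.
move=> gM; have bg := bounded_fun_of_le gM.
have ub n := has_ubound_sdrop (bounded_fun_has_ubound bg) n.
rewrite limn_supE//; split=> [ga e e0|ga].
  have : inf (range (sups g)) < a + e by lra.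
  move=> /inf_lt [|_ [N _ <-] Ne]; first by exists (sups g 0), 0.
  exists N => // n /= Nn; apply: (le_trans _ (ltW Ne)).
  by apply: ub_le_sup => //; exists n.
apply/ler_addgt0Pr => e /ga [N _ Ne].
apply: (@le_trans _ _ (sups g N)).
  by apply: ge_inf; [exact: bounded_fun_has_lbound_sups|exists N].
by apply: ge_sup; [exists (g N), N => /=|move=> _ [n Nn <-]; exact: Ne].
Qed.

Lemma limn_sup_arithmetic_mean_le (R : realType) (g : R ^nat) (M : R) :
  (forall n, `|g n| <= M) -> limn_sup (arithmetic_mean g) <= limn_sup g.
Proof.
move=> gM; apply/(limn_sup_leP _ (normr_cesaro_iter_le 1 gM)) => e e0.
have /(limn_sup_leP _ gM) := lexx (limn_sup g); set a := limn_sup g => ga.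
(* The excess of [g] over its upper limit tends to 0, hence so do its Cesàro means, and they
   dominate those of [g] - [a]. *)
pose x n := Num.max 0 (g n - a).
have x0 : x n @[n --> \oo] --> (0 : R).
  apply/cvgr0Pnorm_le => d d0; have [N _ Nd] := ga _ d0.
  exists N => // n /= Nn; rewrite ger0_norm ?le_max ?lexx// ge_max (ltW d0)/=.
  by rewrite lerBlDl Nd.
have /cvgr0Pnorm_le /(_ _ e0) := cesaro x0; apply: filterS => n /ler_normlW xe.
rewrite -lerBlDl; apply: (le_trans _ xe).
rewrite -[X in _ - X](cesaro_iter_cstE 1 a n).
rewrite -(cesaro_iterBE 1 g (fun=> a)); apply: ler_arithmetic_mean => i _.
by rewrite /x le_max lexx orbT.
Qed.

Lemma Cupper_nonincreasing (R : realType) (phi : R ^nat) (M : R) :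
  (forall n, `|phi n| <= M) ->
  {homo (fun k => Cupper k phi) : j k / (j <= k)%N >-> k <= j}.
Proof.
move=> phiM; apply: homo_leq => [k|y x z xy yz|k]; first exact: lexx.
  exact: le_trans yz xy.
by rewrite /Cupper cesaro_iterS; apply: limn_sup_arithmetic_mean_le;
  exact: normr_cesaro_iter_le.
Qed.

Lemma Cupper_ge (R : realType) k (phi : R ^nat) (M : R) :
  (forall n, `|phi n| <= M) -> - M <= Cupper k phi.
Proof.
move=> phiM; have kM := normr_cesaro_iter_le k phiM.
apply/ler_addgt0Pr => e e0.
have /(limn_sup_leP _ kM) /(_ _ e0) [N _ /(_ N (leqnn N))] :=
  lexx (limn_sup (cesaro_iter k phi)).
move=> Ne; apply: (le_trans _ Ne).
by have := kM N; rewrite ler_norml => /andP[].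
Qed.

Lemma Cupper_cvg (R : realType) (phi : R ^nat) (M : R) :
  (forall n, `|phi n| <= M) -> cvgn (fun k => Cupper k phi).
Proof.
move=> phiM; apply: nonincreasing_is_cvgn.
  exact: Cupper_nonincreasing phiM.
by exists (- M) => _ [k _ <-]; exact: Cupper_ge.
Qed.

Lemma near_le_Cupper_infty (R : realType) (phi : R ^nat) (M e : R) :
  (forall n, `|phi n| <= M) -> 0 < e ->
  \forall k \near \oo, \forall n \near \oo,
    cesaro_iter k phi n <= Cupper_infty phi + e.
Proof.
move=> phiM e0; have e2 : 0 < e / 2 by rewrite divr_gt0.
have : \forall k \near \oo, Cupper k phi < Cupper_infty phi + e / 2.
  by apply: (cvgr_lt _ (Cupper_cvg phiM)); rewrite -/(Cupper_infty phi); lra.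
apply: filterS => k /ltW /(limn_sup_leP _ (normr_cesaro_iter_le k phiM)).
by move=> /(_ _ e2); apply: filterS => n; rewrite -addrA -splitr.
Qed.

Lemma Cupper_infty_le (R : realType) (phi : R ^nat) (M a : R) :
  (forall n, `|phi n| <= M) ->
  (forall e, 0 < e -> exists k, \forall n \near \oo,
    cesaro_iter k phi n <= a + e) ->
  Cupper_infty phi <= a.
Proof.
move=> phiM h; apply/ler_addgt0Pr => e e0; have [k kn] := h _ e0.
apply: (@le_trans _ _ (Cupper k phi)).
  exact: (nonincreasing_cvgn_ge (Cupper_nonincreasing phiM) (Cupper_cvg phiM)).
apply/(limn_sup_leP _ (normr_cesaro_iter_le k phiM)) => d d0.
by apply: filterS kn => n /le_trans; apply; rewrite lerDl ltW.
Qed.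

Lemma Clower_inftyN (R : realType) (phi : R ^nat) (M : R) :
  (forall n, `|phi n| <= M) ->
  Clower_infty phi = - Cupper_infty (fun n => - phi n).
Proof.
move=> phiM; have phiNM n : `|- phi n| <= M by rewrite normrN.
rewrite /Clower_infty /Cupper_infty -limN; last exact: Cupper_cvg phiNM.
congr (limn _); apply/funext => k /=; rewrite /Clower /limn_inf.
have kM := bounded_fun_of_le (normr_cesaro_iter_le k phiNM).
have -> : infs (cesaro_iter k phi) = - sups (cesaro_iter k (fun n => - phi n)).
  rewrite -infsN; congr infs; apply/funext => n.
  by rewrite /= cesaro_iterN opprK.
rewrite limN// ; apply: nonincreasing_is_cvgn.
  exact/nonincreasing_sups/bounded_fun_has_ubound.
exact: bounded_fun_has_lbound_sups.
Qed.

(** Monotonicity in k lets one iterate bound the limit over k, and lets the estimates for [phi] and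
    its negative hold at a common k. *)
Lemma Cinfty_summable_toP (R : realType) (phi : R ^nat) (M alpha : R) :
  (forall n, `|phi n| <= M) ->
  Cinfty_summable_to phi alpha <->
  forall e : R, 0 < e ->
  exists k, \forall n \near \oo, `|cesaro_iter k phi n - alpha| <= e.
Proof.
move=> phiM; have phiNM n : `|- phi n| <= M by rewrite normrN.
rewrite /Cinfty_summable_to (Clower_inftyN phiM); split.
  move=> [up lo] e e0.
  have up' := near_le_Cupper_infty phiM e0; rewrite up in up'.
  have lo' := near_le_Cupper_infty phiNM e0.
  rewrite -[Cupper_infty _]opprK lo in lo'.
  near \oo => k; exists k.
  have u : \forall n \near \oo, cesaro_iter k phi n <= alpha + e by near: k.
  have l : \forall n \near \oo,
    cesaro_iter k (fun n => - phi n) n <= - alpha + e by near: k.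
  near=> n; have un : cesaro_iter k phi n <= alpha + e by near: n.
  have : cesaro_iter k (fun n => - phi n) n <= - alpha + e by near: n.
  by rewrite cesaro_iterN ler_distl; lra.
move=> h; set a := Cupper_infty phi; set b := Cupper_infty (fun n => - phi n).
have aa : a <= alpha.
  apply: (Cupper_infty_le phiM) => e /h [k kn]; exists k.
  by apply: filterS kn => n; rewrite ler_distl => /andP[].
have ba : b <= - alpha.
  apply: (Cupper_infty_le phiNM) => e /h [k kn]; exists k.
  by apply: filterS kn => n; rewrite ler_distl cesaro_iterN => /andP[]; lra.
(* The lower limit does not exceed the upper one: at a common k and n the two estimates add up to 0
   <= a + b + e. With [aa] and [ba] this forces both equalities. *)
have ab : 0 <= a + b.
  apply/ler_addgt0Pr => e e0; have e2 : 0 < e / 2 by rewrite divr_gt0.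
  have up := near_le_Cupper_infty phiM e2; rewrite -/a in up.
  have lo := near_le_Cupper_infty phiNM e2; rewrite -/b in lo.
  near \oo => k.
  have u : \forall n \near \oo, cesaro_iter k phi n <= a + e / 2 by near: k.
  have l : \forall n \near \oo,
    cesaro_iter k (fun n => - phi n) n <= b + e / 2 by near: k.
  near \oo => n; have : cesaro_iter k phi n <= a + e / 2 by near: n.
  have : cesaro_iter k (fun n => - phi n) n <= b + e / 2 by near: n.
  by rewrite cesaro_iterN; lra.
by split; apply/eqP; rewrite eq_le; apply/andP; split; lra.
Unshelve. all: by end_near. Qed.

(** * Uniform convergence of the log means and the equivalence *)

Lemma uniform_cvg_cstP (R : realType) (T : Type) (U : choiceType) (A : set U)
    (F : set_system T) (f : T -> U -> R) (a : R) : Filter F ->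
  {uniform A, f t @[t --> F] --> cst a} <->
  forall e : R, 0 < e -> \forall t \near F, forall u, A u -> `|f t u - a| <= e.
Proof.
move=> FF; split=> [fa e e0|fa P].
  have : nbhs (cst a : {uniform` A -> R})
      [set h | forall u, A u -> `|h u - a| <= e].
    apply/uniform_nbhs; exists [set xy | ball xy.1 e xy.2].
    split; first exact: (entourage_ball _ (PosNum e0)).
    by move=> h /= he u /he; rewrite /ball/= distrC => /ltW.
  by move=> /fa.
move=> /uniform_nbhs [E [entE EP]].
move: entE; rewrite -entourage_ballE => -[e /= e0 eE].
have e2 : 0 < e / 2 by rewrite divr_gt0.
apply: filterS (fa _ e2) => t te; apply: EP => u /te tu; apply: eE.
by rewrite /= /ball/= distrC; lra.
Qed.

Lemma near_pinfty_ln_ge (R : realType) (B : R) : \forall x \near +oo, B <= ln x.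
Proof.
apply: filterS (nbhs_pinfty_ge (num_real (expR B))) => x Bx.
by rewrite -[B]expRK ler_ln ?posrE ?expR_gt0// (lt_le_trans (expR_gt0 B)).
Qed.

Lemma log_meanE (R : realType) (phi : R ^nat) (theta : R) n :
  log_mean phi theta n.+1 =
  (ln theta)^-1 * log_sum phi n (Num.truncn (theta * n.+1%:R)).
Proof. by rewrite /log_mean /log_sum big_add1. Qed.

Lemma log_sum_cst_itv (R : realType) (theta : R) n : 1 < theta ->
  ln theta <= log_sum (fun=> 1) n (Num.truncn (theta * n.+1%:R)) <= 1 + ln theta.
Proof.
move=> t1; have t0 : 0 < theta by lra.
have p0 : 0 < n.+1%:R :> R by [].
have tn0 : 0 <= theta * n.+1%:R by rewrite mulr_ge0// ltW.
have /andP[Nle Ngt] := truncn_itv tn0.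
set N := Num.truncn _ in Nle Ngt *.
have nN : (n < N)%N by rewrite /N truncn_ge_nat// ler_peMl// ltW.
have lnM' : ln (theta * n.+1%:R) = ln theta + ln n.+1%:R by rewrite lnM ?posrE.
apply/andP; split.
  apply: (le_trans _ (log_sum_cst_ge R (ltnW nN))).
  by rewrite lerBrDr -lnM' ler_ln ?posrE ?mulr_gt0// ltW.
apply: (le_trans (log_sum_cst_le R nN)).
rewrite lerD2l lerBlDr -lnM' ler_ln ?posrE ?mulr_gt0// ltr0n.
exact: leq_trans nN.
Qed.

(** The total weight of the window differs from [ln theta] by at most 1, uniformly in n, so
    subtracting [alpha] inside the sum instead of outside costs only this much. *)
Lemma log_mean_sub_cst_le (R : realType) (phi : R ^nat) (alpha theta : R) n :
  1 < theta ->
  `|log_mean phi theta n.+1 - alpha - (ln theta)^-1 *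
      log_sum (fun i => phi i - alpha) n (Num.truncn (theta * n.+1%:R))| <=
  `|alpha| / ln theta.
Proof.
move=> t1; have l0 : 0 < ln theta by rewrite ln_gt0.
have /andP[L1 L2] := log_sum_cst_itv n t1.
set L := log_sum _ _ _ in L1 L2.
rewrite log_meanE; set N := Num.truncn _ in L L1 L2 *.
rewrite (log_sumB phi) log_sum_cst -/L.
have -> : (ln theta)^-1 * log_sum phi n N - alpha -
    (ln theta)^-1 * (log_sum phi n N - alpha * L) =
    alpha * (L - ln theta) / ln theta.
  by field; rewrite gt_eqF.
rewrite !normrM normfV (gtr0_norm l0) ler_wpM2r ?invr_ge0 ?(ltW l0)//.
by rewrite ler_piMr// ler_norml; lra.
Qed.

Theorem theorem7p1 (R : realType) (phi : R ^nat) (alpha : R) :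
  bounded_fun phi ->
  Cinfty_summable_to phi alpha <->
  {uniform [set n : nat | (0 < n)%N],
    log_mean phi theta @[theta --> +oo] --> cst alpha}.
Proof.
move=> /pinfty_ex_gt0 [M _ phiM']; have phiM n : `|phi n| <= M by exact: phiM'.
pose f n := phi n - alpha.
have fM n : `|f n| <= M + `|alpha|.
  by apply: (le_trans (ler_normB _ _)); rewrite lerD2r.
have fE k n : cesaro_iter k f n = cesaro_iter k phi n - alpha.
  by rewrite (cesaro_iterBE k phi (fun=> alpha)) cesaro_iter_cstE.
rewrite (Cinfty_summable_toP _ phiM) uniform_cvg_cstP; split=> [h e e0|h e e0].
  have e4 : 0 < e / 4 by rewrite divr_gt0.
  have [k [N _ kN]] := h _ e4.
  have [K fK] : exists K : R, forall m n,
      `|log_sum f m n| <= K + e / 4 * log_sum (fun=> 1) m n.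
    apply: (log_sum_le_of_cesaro_iter (k := k) (N := N) fM (ltW e4)) => n Nn.
    by rewrite fE; exact: kN.
  near=> theta; case=> // n _.
  have t1 : 1 < theta by near: theta; exact: nbhs_pinfty_gt.
  have l0 : 0 < ln theta by rewrite ln_gt0.
  (* All terms that do not grow with [theta] fit into half of e [ln theta]; the growing term takes
     another quarter. *)
  have lB : (`|alpha| + K + e / 4) / (e / 2) <= ln theta.
    by near: theta; exact: near_pinfty_ln_ge.
  have := log_mean_sub_cst_le phi alpha n t1; rewrite /= -/f.
  have /andP[_] := log_sum_cst_itv n t1.
  have := fK n (Num.truncn (theta * n.+1%:R)).
  set L := log_sum (fun=> 1) _ _; set S := log_sum f _ _ => SK Lle SB.
  have h1 : `|(ln theta)^-1 * S| <= (K + e / 4 * (1 + ln theta)) / ln theta.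
    rewrite mulrC normrM normfV (gtr0_norm l0) ler_wpM2r ?invr_ge0 ?(ltW l0)//.
    by apply: (le_trans SK); rewrite lerD2l ler_pM2l.
  rewrite -[X in `|X|](subrK ((ln theta)^-1 * S)).
  apply: (le_trans (ler_normD _ _)); apply: (le_trans (lerD SB h1)).
  rewrite -mulrDl ler_pdivrMr//.
  have el0 : 0 < e * ln theta by rewrite mulr_gt0.
  by move: lB; rewrite ler_pdivrMr ?divr_gt0//; lra.
have [k kn] : exists k, \forall n \near \oo, `|cesaro_iter k f n| <= e.
  apply: (cesaro_iter_le_of_log_sum fM) => // d d0.
  have d2 : 0 < d / 2 by rewrite divr_gt0.
  have [T [_ hT]] := h _ d2.
  have [T2 [_ hT2]] := near_pinfty_ln_ge (`|alpha| / (d / 2)).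
  (* An integer above both thresholds and above 1. Being an integer, it makes the window end exactly
     at q(n+1), the form the Tauberian lemma requires. *)
  pose q := (Num.truncn (`|T| + `|T2| + 1)).+1.
  have qT : `|T| + `|T2| + 1 < q%:R by exact: truncnS_gt.
  have q1 : 1 < q%:R :> R by have := normr_ge0 T; have := normr_ge0 T2; lra.
  exists q => [|n]; first by rewrite -(ltr1n R).
  have l0 : 0 < ln q%:R :> R by rewrite ln_gt0.
  have Tq : T < q%:R by have := ler_norm T; have := normr_ge0 T2; lra.
  have T2q : T2 < q%:R by have := ler_norm T2; have := normr_ge0 T; lra.
  have h1 := hT _ Tq n.+1 (ltn0Sn n).
  have := hT2 _ T2q; rewrite ler_pdivrMr// => h2.
  have := log_mean_sub_cst_le phi alpha n q1; rewrite /= -natrM natrK -/f => h3.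
  have h4 : `|alpha| / ln q%:R <= d / 2 by rewrite ler_pdivrMr// mulrC.
  set S := log_sum f _ _ in h3 *.
  have : `|(ln q%:R)^-1 * S| <= d.
    have := ler_normB (log_mean phi q%:R n.+1 - alpha)
      (log_mean phi q%:R n.+1 - alpha - (ln q%:R)^-1 * S).
    by rewrite subKr; lra.
  by rewrite normrM normfV (gtr0_norm l0) ler_pdivrMl// mulrC.
by exists k; apply: filterS kn => n; rewrite fE.
Unshelve. all: by end_near. Qed.
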